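(* A binary relation on $\mathbb{T}$ is a lambda congruence if and only if it is a lambda theory, and it is an extensional congruence if and only if it is an extensional theory.
   Context: Let $\mathbb{V}$ be an infinite set whose elements are called variables. The set $\mathbb{T}$ of terms is the set of words inductively defined by: every variable $x$ is a term; if $A,B$ are terms then $[AB]$ is a term; if $x$ is a variable and $A$ a term then $[\lambda x A]$ is a term. Equality of terms is syntactic identity. We abbreviate $[AB]$ as $AB$ and $[\lambda x A]$ as $\lambda x A$. A binary relation $\sim$ on $\mathbb{T}$ is a congruence if it is reflexive, symmetric, transitive, and for all terms $A,B,C,D$ and every variable $x$: $A\sim B$ implies $\lambda x A \sim \lambda x B$, and $A\sim B$, $C \sim D$ imply $AC \sim BD$. A prelambda congruence is a congruence $\sim$ such that for all terms $A,B,D$ and all variables $x,y$: ($\beta_1$) $[\lambda x x]D \sim D$; ($\beta_2$) $[\lambda x y]D \sim y$ whenever $x\neq y$; ($\beta_3$) $[\lambda x[AB]]D \sim [[\lambda x A]D][[\lambda x B]D]$; ($\beta_4$) $[\lambda x[\lambda x A]]D \sim \lambda x A$; ($\beta_5$) if $x \neq y$ and $[\lambda y D]x \sim D$, then $[\lambda x[\lambda y A]]D \sim \lambda y[[\lambda x A]D]$. A lambda congruence is a prelambda congruence satisfying ($\alpha_e$): for every term $A$ and variables $x,y$, if $[\lambda y A]x \sim A$ then $\lambda x A \sim \lambda y[[\lambda x A]y]$. An extensional congruence is a prelambda congruence satisfying ($\eta_e$): $y \sim \lambda x[yx]$ for all variables $x\neq y$. Non-free variables: $\mathrm{NF}(x)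 = \mathbb{V}\setminus\{x\}$, $\mathrm{NF}(BC) = \mathrm{NF}(B)\cap\mathrm{NF}(C)$, $\mathrm{NF}(\lambda x B) = \mathrm{NF}(B)\cup\{x\}$. Non-bound variables: $\mathrm{NB}(x) = \mathbb{V}$, $\mathrm{NB}(BC) = \mathrm{NB}(B)\cap\mathrm{NB}(C)$, $\mathrm{NB}(\lambda x B) = \mathrm{NB}(B)\setminus\{x\}$. Substitution $\langle D/x\rangle(A)$ is defined by induction on $A$: $\langle D/x\rangle(x) = D$; $\langle D/x\rangle(y) = y$ if $x\neq y$; $\langle D/x\rangle(BC) = \langle D/x\rangle(B)\langle D/x\rangle(C)$; $\langle D/x\rangle(\lambda x B) = \lambda x B$; $\langle D/x\rangle(\lambda y B) = \lambda y \langle D/x\rangle(B)$ if $x \neq y$. A lambda theory is a congruence $\sim$ satisfying, for all terms $A,D$ and variables $x,y$: ($\beta$) $[\lambda x A]D \sim \langle D/x\rangle(A)$ whenever $\mathrm{NB}(A)\cup\mathrm{NF}(D) = \mathbb{V}$; ($\alpha$) $\lambda x A \sim \lambda y\langle y/x\rangle(A)$ whenever $y \in \mathrm{NF}(A)\cap\mathrm{NB}(A)$. An extensional theory is a lambda theory satisfying ($\eta$): $A \sim \lambda y[Ay]$ for every term $A$ and variable $y \in \mathrm{NF}(A)$. *)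

(* Defs.v *)
From Stdlib Require Export Relation_Definitions RelationClasses.
From Stdlib Require Import Ensembles ClassicalEpsilon.

Set Implicit Arguments.
Unset Strict Implicit.

(* The words of the paper are uniquely readable, so terms are represented by
   their syntax trees: equality is syntactic identity, and bound variables are
   not identified up to renaming. *)
Inductive term (V : Type) : Type :=
| Var : V -> term V
| App : term V -> term V -> term V
| Lam : V -> term V -> term V.

Section Definitions.

Variable V : Type.

Implicit Types (A B C D : term V) (x y z : V) (R : relation (term V)).

Record congruence R : Prop := {
  congruence_equiv : Equivalence R;
  congruence_lam : forall A B x, R A B -> R (Lam x A) (Lam x B);
  congruence_app : forall A B C D, R A B -> R C D -> R (App A C) (App B D)
}.

Record prelambda_congruence R : Prop := {
  prelambda_is_congruence : congruence R;
  beta1 : forall D x, R (App (Lam x (Var x)) D) D;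
  beta2 : forall D x y, x <> y -> R (App (Lam x (Var y)) D) (Var y);
  beta3 : forall A B D x,
    R (App (Lam x (App A B)) D) (App (App (Lam x A) D) (App (Lam x B) D));
  beta4 : forall A D x, R (App (Lam x (Lam x A)) D) (Lam x A);
  beta5 : forall A D x y,
    x <> y -> R (App (Lam y D) (Var x)) D ->
    R (App (Lam x (Lam y A)) D) (Lam y (App (Lam x A) D))
}.

Record lambda_congruence R : Prop := {
  lambda_congruence_prelambda : prelambda_congruence R;
  alpha_e : forall A x y,
    R (App (Lam y A) (Var x)) A ->
    R (Lam x A) (Lam y (App (Lam x A) (Var y)))
}.

Record extensional_congruence R : Prop := {
  extensional_congruence_prelambda : prelambda_congruence R;
  eta_e : forall x y, x <> y -> R (Var y) (Lam x (App (Var y) (Var x)))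
}.

(* Variables that are not free in a term. *)
Fixpoint NF (A : term V) : Ensemble V :=
  match A with
  | Var x => Complement V (Singleton V x)
  | App B C => Intersection V (NF B) (NF C)
  | Lam x B => Union V (NF B) (Singleton V x)
  end.

(* Variables that are not bound in a term. *)
Fixpoint NB (A : term V) : Ensemble V :=
  match A with
  | Var _ => Full_set V
  | App B C => Intersection V (NB B) (NB C)
  | Lam x B => Setminus V (NB B) (Singleton V x)
  end.

(* [subst D x A] is <D/x>(A).  It does not rename, so it may capture free
   variables of [D].  Equality on the arbitrary set of variables is decided
   classically. *)
Fixpoint subst (D : term V) (x : V) (A : term V) : term V :=
  match A with
  | Var y => if excluded_middle_informative (x = y) then D else Var y
  | App B C => App (subst D x B) (subst D x C)
  | Lam y B =>
      if excluded_middle_informative (x = y) then Lam y B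
      else Lam y (subst D x B)
  end.

Record lambda_theory R : Prop := {
  lambda_theory_congruence : congruence R;
  beta : forall A D x,
    Same_set V (Union V (NB A) (NF D)) (Full_set V) ->
    R (App (Lam x A) D) (subst D x A);
  alpha : forall A x y,
    In V (Intersection V (NF A) (NB A)) y ->
    R (Lam x A) (Lam y (subst (Var y) x A))
}.

Record extensional_theory R : Prop := {
  extensional_theory_lambda : lambda_theory R;
  eta : forall A y, In V (NF A) y -> R A (Lam y (App A (Var y)))
}.

End Definitions.

(* Main.v *)
Require Import Defs.
From Stdlib Require Import FinFun.
From Stdlib Require Import List Ensembles Classical ClassicalEpsilon Setoid Morphisms.

(** Both directions reduce to three facts.

    In a prelambda congruence, [[λy D]E ~ D] holds for every [E] as soon as
    [[λy D]u ~ D] for a single variable [u <> y]: expand the inner [D] of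
    [[λy D]E] into [[λy D]u] and apply (β3), (β4), (β2).  For [y] in [NF(D)] a
    variable [u] not bound in [D] satisfies this by induction on [D], so the
    premise of (β5) is available whenever [y] is in [NF(D)], and (β) follows by
    induction on [A].

    In a lambda theory, (α) makes it possible to move the bound variables of a
    term away from any finite set without losing nonfree variables, so the side
    condition of (β) can always be met.

    If [[λy D]x ~ D] and [x <> y] in a lambda theory, then [D] is congruent to
    [<x/y>(D')], with [D'] a renaming of [D], and [y] is not free in this term.
    Thus the semantic premises of (β5) and (α_e) can be replaced by the syntactic
    condition that [y] is not free. *)

Section Terms.

Variable V : Type.

Implicit Types (A B C D E : term V) (x y z u : V).

(** * Nonfree and nonbound variables, and substitution *)

Lemma NF_Var x y : NF (Var x) y <-> x <> y.
Proof.
  split.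
  - intros H e. apply H. subst. constructor.
  - intros H e. apply H. destruct e. reflexivity.
Qed.

Lemma NF_App A B y : NF (App A B) y <-> NF A y /\ NF B y.
Proof. split; [intros [z]|intros []; constructor]; auto. Qed.

Lemma NF_Lam x A y : NF (Lam x A) y <-> NF A y \/ x = y.
Proof.
  split.
  - intros [z H|z H]; [now left|right]. now destruct H.
  - intros [H|H]; [now left|right]. subst. constructor.
Qed.

Lemma NB_Var x y : NB (Var x) y.
Proof. constructor. Qed.

Lemma NB_App A B y : NB (App A B) y <-> NB A y /\ NB B y.
Proof. split; [intros [z]|intros []; constructor]; auto. Qed.

Lemma NB_Lam x A y : NB (Lam x A) y <-> NB A y /\ x <> y.
Proof.
  split.
  - intros [H n]. split; [exact H|]. intros e. apply n. subst. constructor.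
  - intros [H n]. split; [exact H|]. intros e. apply n. now destruct e.
Qed.

Lemma NB_NF_full A D :
  Same_set V (Union V (NB A) (NF D)) (Full_set V) <->
  forall z, NB A z \/ NF D z.
Proof.
  split.
  - intros [_ H] z. destruct (H z); [constructor|now left|now right].
  - intros H. split; intros z _; [constructor|].
    destruct (H z); [now left|now right].
Qed.

Lemma subst_fresh A D x : NF A x -> subst D x A = A.
Proof.
  induction A as [y|A IHA B IHB|y A IHA]; simpl subst; intros H.
  - apply NF_Var in H. destruct excluded_middle_informative; congruence.
  - apply NF_App in H as [HA HB]. now rewrite IHA, IHB.
  - apply NF_Lam in H as [H|H]; destruct excluded_middle_informative;
      auto; [now rewrite IHA|congruence].
Qed.

Lemma subst_Var_self A x : subst (Var x) x A = A.
Proof.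
  induction A as [y|A IHA B IHB|y A IHA]; simpl;
    try destruct excluded_middle_informative; congruence.
Qed.

Lemma NF_subst_self A D x : NF D x -> NF (subst D x A) x.
Proof.
  intros HD. induction A as [y|A IHA B IHB|y A IHA]; simpl subst.
  - destruct excluded_middle_informative; [easy|now apply NF_Var; auto].
  - now apply NF_App.
  - destruct excluded_middle_informative; apply NF_Lam; auto.
Qed.

Lemma NF_subst A D x z : NF A z -> NF D z -> NF (subst D x A) z.
Proof.
  intros HA HD. induction A as [y|A IHA B IHB|y A IHA]; simpl subst.
  - now destruct excluded_middle_informative.
  - apply NF_App in HA as []. apply NF_App; auto.
  - apply NF_Lam in HA as [H|H]; destruct excluded_middle_informative;
      apply NF_Lam; auto.
Qed.

Lemma NB_subst_Var A x y z : NB A z -> NB (subst (Var y) x A) z.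
Proof.
  induction A as [w|A IHA B IHB|w A IHA]; simpl subst; intros H.
  - destruct excluded_middle_informative; apply NB_Var.
  - apply NB_App in H as []. apply NB_App; auto.
  - destruct excluded_middle_informative; [easy|].
    apply NB_Lam in H as []. apply NB_Lam; auto.
Qed.

Lemma finite_support A :
  exists l, forall y, ~ List.In y l -> NF A y /\ NB A y.
Proof.
  induction A as [x|A [l IHl] B [m IHm]|x A [l IHl]].
  - exists (x :: nil). intros y H. split; [|apply NB_Var].
    apply NF_Var. intros e. apply H. now left.
  - exists (l ++ m). intros y H. rewrite in_app_iff in H.
    destruct (IHl y), (IHm y); [tauto..|].
    split; [now apply NF_App|now apply NB_App].
  - exists (x :: l). intros y H. simpl in H.
    destruct (IHl y); [tauto|].
    split; [apply NF_Lam|apply NB_Lam]; tauto.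
Qed.

Hypothesis V_infinite : ~ Finite V.

(** The infinitude of [V] enters here; combined with [finite_support] this yields fresh
    variables. *)
Lemma exists_notin (l : list V) : exists u, ~ List.In u l.
Proof.
  apply NNPP. intros H. apply V_infinite. exists l. intros u.
  apply NNPP. intros Hu. apply H. now exists u.
Qed.

Variable R : relation (term V).

Infix "~~" := R (at level 70).

Section Congruence.

Hypothesis R_congruence : congruence R.

#[local] Instance R_equivalence : Equivalence R.
Proof. exact (congruence_equiv R_congruence). Qed.

#[local] Instance Lam_proper : Proper (eq ==> R ==> R) (@Lam V).
Proof. intros x _ <- A B H. now apply (congruence_lam R_congruence). Qed.

#[local] Instance App_proper : Proper (R ==> R ==> R) (@App V).
Proof. intros A B H C D K. now apply (congruence_app R_congruence). Qed.

(** * From a prelambda congruence to (β), (α) and (η) *)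

Section Prelambda.

Hypothesis R_prelambda : prelambda_congruence R.

Lemma fresh_app_Var D x y :
  NF D y -> NB D x -> App (Lam y D) (Var x) ~~ D.
Proof.
  induction D as [z|A IHA B IHB|z D IHD]; intros HF HB.
  - apply NF_Var in HF. apply (beta2 R_prelambda). auto.
  - apply NF_App in HF as []. apply NB_App in HB as [].
    now rewrite (beta3 R_prelambda), IHA, IHB.
  - apply NB_Lam in HB as [HB zx].
    destruct (classic (y = z)) as [<-|yz].
    + apply (beta4 R_prelambda).
    + apply NF_Lam in HF as [HF|e]; [|congruence].
      rewrite (beta5 R_prelambda).
      * now rewrite IHD.
      * auto.
      (* The argument is the variable [x], which differs from the binder [z] because it is nonbound,
         so the premise of (β5) is an instance of (β2). *)
      * now apply (beta2 R_prelambda).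
Qed.

Lemma app_const_of_Var D E u y :
  y <> u -> App (Lam y D) (Var u) ~~ D -> App (Lam y D) E ~~ D.
Proof.
  intros yu H.
  transitivity (App (Lam y (App (Lam y D) (Var u))) E).
  - now rewrite H.
  - now rewrite (beta3 R_prelambda), (beta4 R_prelambda),
      (beta2 R_prelambda).
Qed.

Lemma prelambda_fresh_app D E y : NF D y -> App (Lam y D) E ~~ D.
Proof.
  intros H. destruct (finite_support D) as [l Hl].
  destruct (exists_notin (y :: l)) as [u Hu]. simpl in Hu.
  apply app_const_of_Var with u; [tauto|].
  apply fresh_app_Var; [exact H|]. apply Hl. tauto.
Qed.

Lemma beta5_fresh A D x y :
  x <> y -> NF D y ->
  App (Lam x (Lam y A)) D ~~ Lam y (App (Lam x A) D).
Proof.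
  intros xy H. apply (beta5 R_prelambda); [exact xy|].
  now apply prelambda_fresh_app.
Qed.

Lemma prelambda_beta A D x :
  (forall z, NB A z \/ NF D z) -> App (Lam x A) D ~~ subst D x A.
Proof.
  induction A as [y|A IHA B IHB|y A IHA]; simpl subst; intros H.
  - destruct excluded_middle_informative as [<-|n].
    + apply (beta1 R_prelambda).
    + now apply (beta2 R_prelambda).
  - rewrite (beta3 R_prelambda), IHA, IHB; [reflexivity|..];
      intros z; destruct (H z) as [K|K]; try apply NB_App in K; tauto.
  - destruct excluded_middle_informative as [<-|n].
    + apply (beta4 R_prelambda).
    (* The binder [y] is bound in [Lam y A], so the side condition at [y] forces [NF D y], as
       [beta5_fresh] requires. *)
    + rewrite beta5_fresh, IHA; [reflexivity|..|exact n|].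
      * intros z. destruct (H z) as [K|K]; try apply NB_Lam in K; tauto.
      * destruct (H y) as [K|K]; try apply NB_Lam in K; tauto.
Qed.

(** Common end of both equivalences: the hypothesis comes from (α_e) in one and from (η) in the
    other. Contracting its inner redex by (β) turns it into (α). *)
Lemma lambda_theory_of_alpha :
  (forall A x y, NF A y -> Lam x A ~~ Lam y (App (Lam x A) (Var y))) ->
  lambda_theory R.
Proof.
  intros Ha. split.
  - exact R_congruence.
  - intros A D x H. apply prelambda_beta. now apply NB_NF_full.
  - intros A x y [z HF HB]. rewrite (Ha A x z HF) at 1.
    rewrite prelambda_beta; [reflexivity|].
    intros w. destruct (classic (z = w)) as [<-|n]; [now left|right].
    now apply NF_Var.
Qed.

(** The variable case is transported to [A] by abstraction: A ~ [λz z]A ~ [λz λy[zy]]A ~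
    λy[[λz[zy]]A] ~ λy[Ay]. *)
Lemma prelambda_eta :
  (forall x y, x <> y -> Var y ~~ Lam x (App (Var y) (Var x))) ->
  forall A y, NF A y -> A ~~ Lam y (App A (Var y)).
Proof.
  intros He A y H.
  destruct (exists_notin (y :: nil)) as [z Hz]. simpl in Hz.
  rewrite <- (beta1 R_prelambda A z) at 1. rewrite (He y z) by tauto.
  rewrite beta5_fresh, (beta3 R_prelambda), (beta1 R_prelambda),
    (beta2 R_prelambda); [reflexivity|..]; auto.
Qed.

End Prelambda.

(** * From a lambda theory to the prelambda axioms and (α_e) *)

Section Theory.

Hypothesis R_theory : lambda_theory R.

Lemma theory_beta A D x :
  (forall z, NB A z \/ NF D z) -> App (Lam x A) D ~~ subst D x A.
Proof. intros H. apply (Defs.beta R_theory). now apply NB_NF_full. Qed.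

Lemma theory_beta_Var A x y :
  NB A y -> App (Lam x A) (Var y) ~~ subst (Var y) x A.
Proof.
  intros H. apply theory_beta. intros z.
  destruct (classic (y = z)) as [<-|n]; [now left|right]. now apply NF_Var.
Qed.

Lemma rename_bound (l : list V) A :
  exists A', A ~~ A' /\ (forall z, List.In z l -> NB A' z) /\
    (forall z, NF A z -> NF A' z).
Proof.
  induction A as [x|A [A' [HA [bA fA]]] B [B' [HB [bB fB]]]
                 |x A [A' [HA [bA fA]]]].
  - exists (Var x). split; [reflexivity|]. split; [|easy].
    intros z _. apply NB_Var.
  - exists (App A' B'). split; [now rewrite HA, HB|]. split; intros z H.
    + apply NB_App; auto.
    + apply NF_App in H as []. apply NF_App; auto.
  - destruct (finite_support A') as [m Hm].
    (* Avoiding [l] keeps the new binder away from the prescribed variables; avoiding [m] makes (α)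
       applicable to [A']. *)
    destruct (exists_notin (x :: l ++ m)) as [y Hy].
    simpl in Hy. rewrite in_app_iff in Hy.
    destruct (Hm y) as [yF yB]; [tauto|].
    exists (Lam y (subst (Var y) x A')). split; [|split]; try intros z H.
    + rewrite HA. apply (alpha R_theory). now split.
    + apply NB_Lam. split; [now apply NB_subst_Var, bA|].
      intros ->. tauto.
    + destruct (classic (y = z)) as [e|n]; apply NF_Lam; [now right|left].
      apply NF_Lam in H as [H|<-].
      * apply NF_subst; [now apply fA|now apply NF_Var].
      * now apply NF_subst_self, NF_Var.
Qed.

Lemma rename_bound_for D A :
  exists A', A ~~ A' /\ (forall z, NB A' z \/ NF D z) /\
    (forall z, NF A z -> NF A' z).
Proof.
  destruct (finite_support D) as [l Hl].
  destruct (rename_bound l A) as [A' [HA [bA fA]]].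
  exists A'. split; [exact HA|]. split; [|exact fA]. intros z.
  destruct (classic (List.In z l)); [left; auto|right; now apply Hl].
Qed.

Lemma theory_fresh_app A D x : NF A x -> App (Lam x A) D ~~ A.
Proof.
  intros H. destruct (rename_bound_for D A) as [A' [HA [bA fA]]].
  rewrite HA, theory_beta by exact bA.
  now rewrite subst_fresh by auto.
Qed.

Lemma fresh_representative D x y :
  x <> y -> App (Lam y D) (Var x) ~~ D -> exists D', D ~~ D' /\ NF D' y.
Proof.
  intros xy H.
  destruct (rename_bound (x :: nil) D) as [D' [HD [bD _]]].
  exists (subst (Var x) y D'). split.
  - rewrite <- H, HD. apply theory_beta_Var, bD. now left.
  - now apply NF_subst_self, NF_Var.
Qed.

Lemma lambda_theory_prelambda : prelambda_congruence R.
Proof.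
  split.
  - exact R_congruence.
  - intros D x. rewrite theory_beta by (left; apply NB_Var). simpl.
    now destruct excluded_middle_informative.
  - intros D x y xy. apply theory_fresh_app. apply NF_Var. auto.
  - intros A B D x.
    destruct (rename_bound_for D A) as [A' [HA [bA _]]].
    destruct (rename_bound_for D B) as [B' [HB [bB _]]].
    rewrite HA, HB, !theory_beta; [reflexivity|auto..].
    intros z. destruct (bA z); [|now right]. destruct (bB z); [|now right].
    left. now apply NB_App.
  - intros A D x. apply theory_fresh_app. apply NF_Lam. now right.
  - intros A D x y xy H.
    (* With [y] nonfree in [D'], the binder [y] does not obstruct (β) for [Lam y A']. *)
    destruct (fresh_representative D x y xy H) as [D' [HD fD]].
    destruct (rename_bound_for D' A) as [A' [HA [bA _]]].
    rewrite HD, HA, !theory_beta; [|exact bA|].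
    + simpl. destruct excluded_middle_informative; [congruence|reflexivity].
    + intros z. destruct (classic (y = z)) as [<-|n]; [now right|].
      destruct (bA z); [left|now right]. now apply NB_Lam.
Qed.

Lemma lambda_theory_alpha_e A x y :
  App (Lam y A) (Var x) ~~ A -> Lam x A ~~ Lam y (App (Lam x A) (Var y)).
Proof.
  intros H. destruct (classic (x = y)) as [<-|xy]; [now rewrite H|].
  destruct (fresh_representative A x y xy H) as [A1 [H1 f1]].
  (* [A1] may still bind [y], whereas (α) needs [y] nonbound as well; the renaming keeps it
     nonfree. *)
  destruct (rename_bound (y :: nil) A1) as [A2 [H2 [b2 f2]]].
  assert (NB A2 y) by (apply b2; now left).
  rewrite H1, H2, theory_beta_Var by assumption.
  apply (alpha R_theory). split; [now apply f2|assumption].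
Qed.

End Theory.

End Congruence.

(** * The two equivalences *)

Lemma lambda_congruence_theory : lambda_congruence R -> lambda_theory R.
Proof.
  intros [Hp Ha]. pose proof (prelambda_is_congruence Hp) as Hc.
  apply lambda_theory_of_alpha; [exact Hc|exact Hp|].
  intros A x y H. now apply Ha, prelambda_fresh_app.
Qed.

Lemma lambda_theory_lambda_congruence :
  lambda_theory R -> lambda_congruence R.
Proof.
  intros H. pose proof (lambda_theory_congruence H) as Hc. split.
  - now apply lambda_theory_prelambda.
  - intros A x y. now apply lambda_theory_alpha_e.
Qed.

Lemma extensional_congruence_theory :
  extensional_congruence R -> extensional_theory R.
Proof.
  intros [Hp He]. pose proof (prelambda_is_congruence Hp) as Hc.
  pose proof (prelambda_eta Hc Hp He) as Heta. split; [|exact Heta].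
  apply lambda_theory_of_alpha; [exact Hc|exact Hp|].
  (* This is (η) at the abstraction [Lam x A], in which [y] is nonfree. *)
  intros A x y H. apply Heta, NF_Lam. now left.
Qed.

Lemma extensional_theory_congruence :
  extensional_theory R -> extensional_congruence R.
Proof.
  intros [Ht He]. split.
  - apply lambda_theory_prelambda; [|exact Ht].
    exact (lambda_theory_congruence Ht).
  - intros x y xy. apply He, NF_Var. auto.
Qed.

End Terms.

Theorem theorem8p6 (V : Type) (V_infinite : ~ Finite V)
    (R : relation (term V)) :
  (lambda_congruence R <-> lambda_theory R) /\
  (extensional_congruence R <-> extensional_theory R).
Proof.
  split; split.
  - now apply lambda_congruence_theory.
  - now apply lambda_theory_lambda_congruence.
  - now apply extensional_congruence_theory.
  - now apply extensional_theory_congruence.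
Qed.
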